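(* Let $\mathcal{H}$ be a nonempty finite class of hypotheses $h:X\to\{-1,+1\}$ and let $m\ge 1$ be an integer. For any probability distribution $D$ on $X\times\{-1,+1\}$, any instance $x\in X$, any $\lambda>0$, any $\eta>0$ and any $s\in\{-1,+1\}$, $$\Pr_{S\sim D^m}\left[s\bigl(\ell_\eta(x)-\hat\ell_\eta(x)\bigr)\ge 2\lambda+\frac{\eta}{8m}\right]\le 2e^{-2\lambda^2 m},$$ where $\ell_\eta(x)$ is the true log ratio and $\hat\ell_\eta(x)$ is the empirical log ratio computed from the sample $S$.
   Context: $X$ is a measurable space and all hypotheses are measurable. $S=((x_1,y_1),\dots,(x_m,y_m))$ is a sample of $m$ examples drawn independently from $D$. For $h\in\mathcal{H}$, the true error is $\varepsilon(h)=\Pr_{(x,y)\sim D}[h(x)\ne y]$ and the empirical error is $\hat\varepsilon(h)=\frac1m\sum_{i=1}^m \mathbf{1}[h(x_i)\ne y_i]$. For $\eta>0$ and $x\in X$, the true and empirical log ratios are $$\ell_\eta(x)=\frac1\eta\ln\frac{\sum_{h\in\mathcal{H}:h(x)=+1}e^{-\eta\varepsilon(h)}}{\sum_{h\in\mathcal{H}:h(x)=-1}e^{-\eta\varepsilon(h)}},\qquad \hat\ell_\eta(x)=\frac1\eta\ln\frac{\sum_{h\in\mathcal{H}:h(x)=+1}e^{-\eta\hat\varepsilon(h)}}{\sum_{h\in\mathcal{H}:h(x)=-1}e^{-\eta\hat\varepsilon(h)}}.$$ Convention: if all hypotheses agree on $x$, both log ratios equal $+\infty$ (if all predict $+1$)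 or both equal $-\infty$ (if all predict $-1$), and then the difference $\ell_\eta(x)-\hat\ell_\eta(x)$ is read as $0$. *)

(* Defs.v *)
From HB Require Import structures.
From mathcomp Require Import all_boot all_order all_algebra.
From mathcomp Require Import all_classical all_reals all_analysis.

Set Implicit Arguments.
Unset Strict Implicit.
Unset Printing Implicit Defensive.

Import Order.TTheory GRing.Theory Num.Theory.

Local Open Scope classical_set_scope.
Local Open Scope ring_scope.

(* Labels in {-1,+1} are encoded as booleans (discrete sigma-algebra), with
   [true] standing for +1 and [false] for -1.  An example is an element of
   [X * bool], a hypothesis a function [X -> bool]. *)

Section power_probability.
Context d (T : measurableType d) (R : realType).

Definition tcons n (p : T * n.-tuple T) : n.+1.-tuple T :=
  [tuple of p.1 :: p.2].

Lemma measurable_tcons n : measurable_fun setT (@tcons n).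
Proof. exact: measurable_cons. Qed.

HB.instance Definition _ n := isMeasurableFun.Build _ _ _ _
  (@tcons n) (@measurable_tcons n).

(* The law D^n of n independent draws from D, on the product sigma-algebra of
   [n.-tuple T]: D^0 is the point mass at the empty tuple, and D^(n+1) is the
   image of the product measure D x D^n under [(z, S) |-> z :: S]. *)
Fixpoint power_probability (D : probability T R) n :
    probability (n.-tuple T) R :=
  if n is k.+1 then
    distribution (D \x power_probability D k)%E (@tcons k)
  else dirac [tuple].

Lemma power_probabilityE (D : probability T R) n (A : 'I_n -> set T) :
  (forall i, measurable (A i)) ->
  power_probability D n [set S | forall i, A i (tnth S i)]
  = (\prod_(i < n) D (A i))%E.
Proof.
elim: n A => [|n IHn] A mA /=.
  by rewrite big_ord0 diracE mem_set// => -[].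
rewrite big_ord_recl -IHn => [|i]; last exact: mA.
rewrite /distribution /pushforward /=.
have -> : @tcons n @^-1` [set S | forall i, A i (tnth S i)] =
    A ord0 `*` [set S | forall i, A (lift ord0 i) (tnth S i)].
  apply/seteqP; split => -[z S] /=.
  - by move=> h; split=> [|i]; [exact: (h ord0) | move: (h (lift ord0 i)); rewrite tnthS].
  - case=> h0 hS i; have [->//|i0] := eqVneq i ord0.
    by move: i0; case: (unliftP ord0 i) => [j ->|->//] _; rewrite tnthS; exact: hS.
rewrite product_measure1E//.
rewrite (_ : [set S | _] =
    \bigcap_(i in [set: 'I_n]) ((fun S : n.-tuple T => tnth S i) @^-1` A (lift ord0 i))).
  apply: fin_bigcap_measurable => [|i _]; first exact: finite_finset.
  rewrite -[X in measurable X]setTI; exact: measurable_tnth.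
by apply/seteqP; split => S /= h i; [move=> _; exact: h | exact: (h i)].
Qed.

End power_probability.

Section log_ratio.
Context d (X : measurableType d) (R : realType).
Implicit Types (H : set (X -> bool)) (h : X -> bool).

Definition true_error (D : probability (X * bool)%type R) h : R :=
  fine (D [set z | h z.1 <> z.2]).

Definition empirical_error m (S : m.-tuple (X * bool)%type) h : R :=
  m%:R^-1 * \sum_(i < m) (h (tnth S i).1 != (tnth S i).2)%:R.

Definition label_weight H (err : (X -> bool) -> R) (eta : R) (x : X)
    (y : bool) : R :=
  \sum_(h \in [set h | H h /\ h x = y]) expR (- (eta * err h)).

(* The log ratio attached to an error function on hypotheses; it is infinite
   exactly when all the hypotheses of (a nonempty) H agree on x. *)
Definition log_ratio H (err : (X -> bool) -> R) (eta : R) (x : X) : \bar R :=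
  if `[< forall h, H h -> h x = true >] then +oo%E
  else if `[< forall h, H h -> h x = false >] then -oo%E
  else (eta^-1 * ln (label_weight H err eta x true /
                     label_weight H err eta x false))%:E.

Definition true_log_ratio H (D : probability (X * bool)%type R) :=
  log_ratio H (true_error D).

Definition empirical_log_ratio H m (S : m.-tuple (X * bool)%type) :=
  log_ratio H (empirical_error S).

(* Difference of log ratios; unlike [-] on [\bar R], where both
   [+oo - +oo] and [-oo - -oo] are [-oo], these are read as [0]. *)
Definition log_ratio_diff (a b : \bar R) : \bar R :=
  if a == b then 0%E else (a - b)%E.

End log_ratio.

(* Main.v *)
Require Import Defs.
From mathcomp Require Import all_boot all_order all_algebra.
From mathcomp Require Import all_classical all_reals all_analysis.
From mathcomp Require Import ring lra.

Set Implicit Arguments.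
Unset Strict Implicit.
Unset Printing Implicit Defensive.

Import Order.TTheory GRing.Theory Num.Theory.
Import numFieldNormedType.Exports.

Local Open Scope classical_set_scope.
Local Open Scope ring_scope.

(** For a label y put F_y(u) = (1 / eta) ln (sum of exp (- eta u_h) over the
    hypotheses h that predict y on the given instance), a function of the vector
    u of errors. A log ratio is F_true - F_false, so the difference between the
    true and the empirical log ratio is controlled by the deviation of
    F_y(empirical errors) from F_y(true errors), for the two labels separately.

    - Concentration. Replacing one example moves every empirical error by at
      most 1/m, hence moves F_y by at most 1/m ([log_partition_le_sup]).
      McDiarmid's inequality ([mcdiarmid_upper_tail], [mcdiarmid_lower_tail])
      bounds the probability of a deviation by at least lambda from the
      expectation, on a given side, by exp (- 2 lambda^2 m).
    - Bias. The expectation of F_y(empirical errors) lies between F_y(true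
      errors), by convexity of F_y ([log_partition_mean_loss_le]), and
      F_y(true errors) + eta / (8 m), by concavity of ln and a bound on the
      moment generating function of an average of m independent losses
      ([sample_mean_log_partition_le]).

    If the signed difference reaches 2 lambda + eta / (8 m), then one of the
    two F_y deviates from its expectation by at least lambda in a prescribed
    direction, and the union bound gives the factor 2 ([log_partition_gap_tail]).

    The event depends on an example only through the pattern recording which
    hypotheses err on it, and there are finitely many patterns. The law of the
    sample of patterns is a product of finite distributions
    ([power_probability_image]), so that all the expectations above are finite
    sums and McDiarmid's inequality is an induction on the sample size whose
    step is Hoeffding's lemma ([hoeffding_mgf_le]). *)

(** * Moment generating function of a Bernoulli variable *)

Lemma convex_critical_point_ge0 (R : realType) (f df ddf : R -> R) (u : R) :
  (forall x : R, is_derive x 1 f (df x)) ->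
  (forall x : R, is_derive x 1 df (ddf x)) ->
  (forall x, 0 <= ddf x) -> f 0 = 0 -> df 0 = 0 -> 0 <= f u.
Proof.
move=> Df Ddf ddf_ge0 f0 df0.
have cont (g dg : R -> R) : (forall x : R, is_derive x 1 g (dg x)) ->
    forall a b, {within `[a, b], continuous g}.
  move=> Dg a b; apply: continuous_subspaceT => x.
  by apply/differentiable_continuous/derivable1_diffP; have [] := Dg x.
have [u0|u0|<-] := ltgtP 0 u; last by rewrite f0.
- have [c + e1] := MVT u0 (fun x _ => Df x) (cont _ _ Df 0 u).
  rewrite in_itv/= => /andP[c0 _].
  have [b + e2] := MVT c0 (fun x _ => Ddf x) (cont _ _ Ddf 0 c).
  rewrite in_itv/= => _.
  have := ddf_ge0 b; move: e1 e2; rewrite f0 df0 !subr0 => -> -> ?.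
  by rewrite !mulr_ge0 // ltW.
- have [c + e1] := MVT u0 (fun x _ => Df x) (cont _ _ Df u 0).
  rewrite in_itv/= => /andP[_ c0].
  have [b + e2] := MVT c0 (fun x _ => Ddf x) (cont _ _ Ddf c 0).
  rewrite in_itv/= => _.
  move: e1 e2; rewrite f0 df0 !sub0r !mulrN => /oppr_inj -> /oppr_inj ->.
  by rewrite mulr_le0 ?mulr_ge0_le0 // ltW.
Qed.

(** The logarithm of the left-hand side has second derivative r (1 - r) for a
    probability r, hence at most 1/4, and it agrees to first order at u = 0
    with the exponent on the right. *)
Lemma bernoulli_mgf_le (R : realType) (q u : R) : 0 <= q <= 1 ->
  1 - q + q * expR u <= expR (q * u + u ^+ 2 / 8).
Proof.
move=> /andP[q0 q1].
pose den (v : R) : R := 1 - q + q * expR v.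
have den_gt0 v : 0 < den v.
  by rewrite /den; have := expR_gt0 v; nra.
rewrite -ler_ln ?posrE ?expR_gt0 ?den_gt0// expRK -subr_ge0.
have Dden (v : R) : is_derive v 1 den (q * expR v).
  have := is_deriveD (is_derive_cst (1 - q) v 1)
    (is_deriveZ q (is_derive_expR v)).
  by rewrite add0r.
pose r (v : R) : R := q * expR v / den v.
pose G (v : R) : R := q * v + v ^+ 2 / 8 - ln (den v).
pose dG (v : R) : R := q + v / 4 - r v.
pose ddG (v : R) : R := 4^-1 - r v * (1 - r v).
apply: (@convex_critical_point_ge0 _ G dG ddG).
- move=> v.
  have Dq := is_deriveZ q (is_derive_id v 1).
  have Dsq := is_deriveZ 8^-1 (is_deriveX 2 (is_derive_id v 1)).
  have Dln := is_derive1_comp (is_derive1_ln (den_gt0 v)) (Dden v).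
  have -> : G = (q \*: id) + (8^-1 \*: (id ^+ 2)) - (@ln R \o den) :> (R -> R).
    by apply/funext => y; rewrite /G/= [_ / 8]mulrC.
  apply: (is_derive_eq (is_deriveB (is_deriveD Dq Dsq) Dln)).
  rewrite /dG /r /GRing.scale/= expr1.
  by have := den_gt0 v; move=> ?; field; rewrite gt_eqF.
- move=> v.
  have den0 : den v != 0 by rewrite gt_eqF.
  have Dlin := is_deriveZ 4^-1 (is_derive_id v 1).
  have Dinv := is_deriveZ (1 - q) (is_deriveV den0 (Dden v)).
  have -> : dG = cst (q - 1) + (4^-1 \*: id) + ((1 - q) \*: (fun y => (den y)^-1))
      :> (R -> R).
    apply/funext => y; have : den y != 0 by rewrite gt_eqF.
    rewrite /dG /r /den /cst /GRing.scale /= => ?.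
    change (q + y / 4 - q * expR y / (1 - q + q * expR y) =
      q - 1 + 4^-1 * y + (1 - q) * (1 - q + q * expR y)^-1).
    by field.
  apply: (is_derive_eq (is_deriveD (is_deriveD (is_derive_cst (q - 1) v 1) Dlin) Dinv)).
  rewrite /ddG /r /GRing.scale/=; move: den0; rewrite /den => ?.
  by field.
- by move=> v; rewrite /ddG; have := sqr_ge0 (r v - 2^-1); nra.
- by rewrite /G /den expR0 mulr0 expr0n mul0r addr0 mulr1 subrK ln1 subrr.
- by rewrite /dG /r /den expR0 mulr1 subrK divr1 mul0r addr0 subrr.
Qed.

(** * Bounded differences *)

Definition bounded_differences (R : realType) (T : Type) n
    (f : n.-tuple T -> R) (c : R) : Prop :=
  forall w w' i, (forall j, j != i -> tnth w j = tnth w' j) -> f w - f w' <= c.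

Section Expectation.
Context (R : realType) (T : finType) (p : T -> R).
Hypothesis p_ge0 : forall a, 0 <= p a.
Hypothesis p_sum1 : \sum_a p a = 1.

(** Convexity bounds exp on an interval of length c by its chord, which
    replaces g by a two-point variable with the same mean; the previous lemma
    then applies. *)
Lemma hoeffding_mgf_le (g : T -> R) (c t : R) : 0 < c ->
  (forall a b, g a - g b <= c) ->
  \sum_a p a * expR (t * g a) <=
  expR (t * (\sum_a p a * g a) + t ^+ 2 * c ^+ 2 / 8).
Proof.
move=> c_gt0 gc.
have [a0|T0] := pickP (@predT T); last first.
  by move: p_sum1; rewrite big_pred0// => /esym/eqP; rewrite oner_eq0.
move=> _; have [b _ gb] := arg_minP g (erefl (predT a0)).
(* The range of g is contained in [g b, g b + c]; y is the position in it. *)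
set u := t * c; pose y a := (g a - g b) / c.
have y01 a : 0 <= y a <= 1.
  by rewrite divr_ge0 ?subr_ge0 ?gb ?(ltW c_gt0)//= ler_pdivrMr ?mul1r.
(* Both end points lie above the tangent of exp at z * v, and the tangents
   average out to its value there. *)
have chord v z : 0 <= z <= 1 -> expR (z * v) <= 1 - z + z * expR v.
  move=> /andP[z0 z1].
  have := expR_ge1Dx (v - z * v); have := expR_ge1Dx (- (z * v)).
  have e0 := expR_gt0 (z * v).
  have e1 : expR (z * v) * expR (- (z * v)) = 1 by rewrite -expRD subrr expR0.
  have e2 : expR (z * v) * expR (v - z * v) = expR v.
    by rewrite -expRD addrC subrK.
  rewrite -(ler_pM2l e0) e1 => h1; rewrite -(ler_pM2l e0) e2 => h2.
  have z1' : 0 <= 1 - z by lra.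
  have := ler_wpM2l z0 h2; have := ler_wpM2l z1' h1; nra.
set q := \sum_a p a * y a.
have mean_y : \sum_a p a * g a = g b + c * q.
  rewrite /q mulr_sumr -[g b in RHS]mulr1 -p_sum1 mulr_sumr -big_split/=.
  by apply: eq_bigr => a _; rewrite /y; field; rewrite gt_eqF.
have q01 : 0 <= q <= 1.
  apply/andP; split.
    by apply: sumr_ge0 => a _; rewrite mulr_ge0//; case/andP: (y01 a).
  rewrite -p_sum1; apply: ler_sum => a _.
  by rewrite ler_piMr//; case/andP: (y01 a).
apply: (@le_trans _ _ (expR (t * g b) * (1 - q + q * expR u))).
  have -> : 1 - q + q * expR u = \sum_a p a * (1 - y a + y a * expR u).
    rewrite /q -[X in X - _]p_sum1 mulr_suml -sumrB -big_split/=.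
    by apply: eq_bigr => a _; ring.
  rewrite mulr_sumr; apply: ler_sum => a _; rewrite mulrCA ler_wpM2l//.
  have -> : t * g a = t * g b + y a * u.
    by rewrite /y /u; field; rewrite gt_eqF.
  by rewrite expRD ler_wpM2l ?expR_ge0 ?chord.
apply: (le_trans (ler_wpM2l (expR_ge0 _) (bernoulli_mgf_le _ q01))).
rewrite -expRD mean_y ler_expR le_eqVlt; apply/orP; left; apply/eqP.
by rewrite /u; field.
Qed.

Definition sample_weight n (w : n.-tuple T) : R :=
  \prod_(i < n) p (tnth w i).

(** The expectation of f over n independent draws from p. *)
Definition sample_mean n (f : n.-tuple T -> R) : R :=
  \sum_w sample_weight w * f w.

Lemma sample_weight_ge0 n (w : n.-tuple T) : 0 <= sample_weight w.
Proof. exact: prodr_ge0. Qed.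

Lemma sample_mean_cons n (f : n.+1.-tuple T -> R) :
  sample_mean f =
  \sum_a p a * sample_mean (fun w : n.-tuple T => f [tuple of a :: w]).
Proof.
under eq_bigr do rewrite mulr_sumr.
rewrite pair_big /=.
rewrite /sample_mean.
rewrite (reindex (fun q : T * n.-tuple T => [tuple of q.1 :: q.2]))/=; last first.
  exists (fun w => (thead w, [tuple of behead w])) => [[a w] _|w _] /=.
    by congr (_, _); apply/val_inj.
  by rewrite -tuple_eta.
apply: eq_bigr => -[a w] _ /=; rewrite mulrA; congr (_ * _).
rewrite /sample_weight big_ord_recl; congr (_ * _).
by apply: eq_bigr => i _; rewrite tnthS.
Qed.

Lemma sample_mean_cst n c : sample_mean (fun _ : n.-tuple T => c) = c.
Proof.
elim: n => [|n IH].
  rewrite /sample_mean (big_pred1 [tuple]) => [|w].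
    by rewrite /sample_weight big_ord0 mul1r.
  by rewrite [w]tuple0 /= eqxx.
rewrite sample_mean_cons; under eq_bigr do rewrite IH.
by rewrite -mulr_suml p_sum1 mul1r.
Qed.

Lemma sample_meanD n (f g : n.-tuple T -> R) :
  sample_mean (fun w => f w + g w) = sample_mean f + sample_mean g.
Proof. by rewrite -big_split/=; apply: eq_bigr => w _; rewrite mulrDr. Qed.

Lemma sample_meanZ n k (f : n.-tuple T -> R) :
  sample_mean (fun w => k * f w) = k * sample_mean f.
Proof. by rewrite mulr_sumr; apply: eq_bigr => w _; rewrite mulrCA. Qed.

Lemma sample_mean_le n (f g : n.-tuple T -> R) :
  (forall w, f w <= g w) -> sample_mean f <= sample_mean g.
Proof. by move=> fg; apply: ler_sum => w _; rewrite ler_wpM2l ?sample_weight_ge0. Qed.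

Lemma sample_mean_sum n (I : finType) (P : pred I) (f : I -> n.-tuple T -> R) :
  sample_mean (fun w => \sum_(i | P i) f i w) = \sum_(i | P i) sample_mean (f i).
Proof.
rewrite /sample_mean exchange_big; apply: eq_bigr => w _.
by rewrite mulr_sumr.
Qed.

Lemma sample_mean_tnth n (f : T -> R) (j : 'I_n) :
  sample_mean (fun w => f (tnth w j)) = \sum_a p a * f a.
Proof.
elim: n j => [[]//|n IH] j; rewrite sample_mean_cons.
have [k ->|->] := unliftP ord0 j.
  rewrite -(IH k) -[RHS]mul1r -p_sum1 mulr_suml; apply: eq_bigr => a _.
  by congr (_ * sample_mean _); apply/funext => w; rewrite tnthS.
by apply: eq_bigr => a _; rewrite -[f a in RHS](sample_mean_cst n).
Qed.

(** Induction on the sample size: once the first draw is fixed, f has bounded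
    differences in the remaining ones, and their expectation, as a function of
    the first draw, varies by at most c, so that Hoeffding's lemma pays for
    it. *)
Lemma mcdiarmid_mgf_le n (f : n.-tuple T -> R) (c t : R) : 0 < c ->
  bounded_differences f c ->
  sample_mean (fun w => expR (t * f w)) <=
  expR (t * sample_mean f + n%:R * (t ^+ 2 * c ^+ 2 / 8)).
Proof.
move=> c_gt0; elim: n f => [|n IH] f fc.
  have E (g : 0.-tuple T -> R) : g = fun _ => g [tuple].
    by apply/funext => w; rewrite tuple0.
  by rewrite (E f) !sample_mean_cst mul0r addr0.
pose g a := sample_mean (fun w : n.-tuple T => f [tuple of a :: w]).
rewrite !sample_mean_cons -/g.
apply: (@le_trans _ _ (\sum_a p a * expR (t * g a) *
    expR (n%:R * (t ^+ 2 * c ^+ 2 / 8)))).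
  apply: ler_sum => a _; rewrite -mulrA ler_wpM2l// -expRD.
  apply: IH => w w' i ww'; apply: (fc _ _ (lift ord0 i)) => j.
  have [k ->|->] := unliftP ord0 j => // ki.
  by rewrite !tnthS; apply: ww'; apply: contra_neq ki => ->.
rewrite -mulr_suml.
have gc a b : g a - g b <= c.
  rewrite -(sample_mean_cst n c) lerBlDr -sample_meanD.
  apply: sample_mean_le => w; rewrite -lerBlDr; apply: (fc _ _ ord0) => j.
  by have [k ->|->] := unliftP ord0 j => //; rewrite !tnthS.
apply: (le_trans (ler_wpM2r (expR_ge0 _) (hoeffding_mgf_le t c_gt0 gc))).
by rewrite -expRD ler_expR -natr1 le_eqVlt; apply/orP; left; apply/eqP; ring.
Qed.

End Expectation.

Section McDiarmid_tail.
Context (R : realType) (T : finType) (p : T -> R).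
Hypothesis p_ge0 : forall a, 0 <= p a.
Hypothesis p_sum1 : \sum_a p a = 1.

Lemma mcdiarmid_upper_tail n (f : n.-tuple T -> R) (c lambda : R) :
  (0 < n)%N -> 0 < c -> 0 < lambda ->
  bounded_differences f c ->
  sample_mean p (fun w => (sample_mean p f + lambda <= f w)%R%:R) <=
  expR (- (2 * lambda ^+ 2 / (n%:R * c ^+ 2))).
Proof.
move=> n_gt0 c_gt0 lambda_gt0 fc; set mu := sample_mean p f.
have n0 : 0 < n%:R :> R by rewrite ltr0n.
(* This t minimizes the exponent n t^2 c^2 / 8 - t lambda. *)
pose t := 4 * lambda / (n%:R * c ^+ 2).
have t_ge0 : 0 <= t.
  by rewrite !mulr_ge0 ?invr_ge0 ?mulr_ge0 ?exprn_ge0 ?(ltW n0) ?ltW.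
apply: (@le_trans _ _ (sample_mean p
    (fun w => expR (- (t * (mu + lambda))) * expR (t * f w)))).
  apply: sample_mean_le => // w; rewrite -expRD.
  case: (leP (mu + lambda)) => [fw|_]; last by rewrite mulr0n expR_ge0.
  by rewrite mulr1n -{1}expR0 ler_expR addrC subr_ge0 ler_wpM2l.
rewrite sample_meanZ.
apply: (le_trans (ler_wpM2l (expR_ge0 _)
  (mcdiarmid_mgf_le p_ge0 p_sum1 t c_gt0 fc))).
rewrite -expRD -/mu ler_expR le_eqVlt; apply/orP; left; apply/eqP.
by rewrite /t; field; rewrite (gt_eqF n0) (gt_eqF c_gt0).
Qed.

Lemma mcdiarmid_lower_tail n (f : n.-tuple T -> R) (c lambda : R) :
  (0 < n)%N -> 0 < c -> 0 < lambda ->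
  bounded_differences f c ->
  sample_mean p (fun w => (f w <= sample_mean p f - lambda)%R%:R) <=
  expR (- (2 * lambda ^+ 2 / (n%:R * c ^+ 2))).
Proof.
move=> n_gt0 c_gt0 lambda_gt0 fc.
have fNc : bounded_differences (fun w => -1 * f w) c.
  by move=> w w' i ww'; rewrite !mulN1r opprK addrC; apply: (fc _ _ i) => j /ww'.
apply: le_trans (mcdiarmid_upper_tail n_gt0 c_gt0 lambda_gt0 fNc).
apply: sample_mean_le => // w; rewrite sample_meanZ !mulN1r.
by rewrite lerNr opprD opprK.
Qed.

End McDiarmid_tail.

(** * Log partition functions *)

Section Log_partition.
Context (R : realType) (I : finType).
Implicit Types (K : pred I) (u v : I -> R) (eta : R).

Definition partition_function K eta u : R :=
  \sum_(i | K i) expR (- (eta * u i)).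

Definition log_partition K eta u : R := eta^-1 * ln (partition_function K eta u).

Lemma partition_function_gt0 K eta u i0 : K i0 -> 0 < partition_function K eta u.
Proof.
move=> Ki0; rewrite /partition_function (bigD1 i0)//= ltr_pwDl ?expR_gt0//.
by apply: sumr_ge0 => i _; exact: expR_ge0.
Qed.

Lemma log_partition_le_sup K eta u v delta i0 : K i0 -> 0 < eta ->
  (forall i, K i -> v i - u i <= delta) ->
  log_partition K eta u - log_partition K eta v <= delta.
Proof.
move=> Ki0 eta_gt0 uv; rewrite -mulrBr mulrC ler_pdivrMr//.
have Z_gt0 x := partition_function_gt0 eta x Ki0.
rewrite lerBlDl -(expRK (delta * eta)) -lnM ?posrE ?expR_gt0//.
rewrite ler_ln ?posrE ?mulr_gt0 ?expR_gt0// mulr_suml.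
apply: ler_sum => i Ki; rewrite -expRD ler_expR.
have := uv i Ki; nra.
Qed.

(** The tangent of the convex function log_partition at v, with slopes minus
    the Gibbs weights q of v: this is Jensen's inequality for exp under q,
    obtained by bounding exp below by its tangent at the q-mean. *)
Lemma log_partition_tangent K eta u v i0 : K i0 -> 0 < eta ->
  log_partition K eta v +
    \sum_(i | K i) expR (- (eta * v i)) / partition_function K eta v * (v i - u i)
  <= log_partition K eta u.
Proof.
move=> Ki0 eta_gt0.
have Zu := partition_function_gt0 eta u Ki0.
have Zv := partition_function_gt0 eta v Ki0.
set s := \sum_(i | K i) _.
pose q i := expR (- (eta * v i)) / partition_function K eta v.
have q_sum1 : \sum_(i | K i) q i = 1 by rewrite -mulr_suml divff// gt_eqF.
rewrite addrC -lerBrDr -mulrBr -ler_pdivrMl ?invr_gt0// invrK.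
rewrite -ln_div ?posrE// -ler_expR lnK ?posrE ?divr_gt0//.
have -> : partition_function K eta u / partition_function K eta v =
    \sum_(i | K i) q i * expR (eta * (v i - u i)).
  rewrite mulr_suml; apply: eq_bigr => i _.
  by rewrite /q mulrAC -expRD; congr (expR _ / _); ring.
apply: (@le_trans _ _ (\sum_(i | K i) q i *
    (expR (eta * s) * (1 + (eta * (v i - u i) - eta * s))))).
  rewrite le_eqVlt; apply/orP; left; apply/eqP; symmetry.
  transitivity (\sum_(i | K i) (expR (eta * s) * ((1 - eta * s) * q i) +
     expR (eta * s) * eta * (q i * (v i - u i)))).
    by apply: eq_bigr => i _; ring.
  by rewrite big_split/= -!mulr_sumr q_sum1 -/s; ring.
apply: ler_sum => i _; rewrite ler_wpM2l ?divr_ge0 ?expR_ge0 ?(ltW Zv)//.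
apply: (le_trans (ler_wpM2l (expR_ge0 _) (expR_ge1Dx _))).
by rewrite -expRD addrC subrK.
Qed.

End Log_partition.

(** * Concentration of the empirical log partition function *)

Section Empirical_log_partition.
Context (R : realType) (T I : finType) (p : T -> R) (loss : I -> T -> R).
Hypothesis p_ge0 : forall a, 0 <= p a.
Hypothesis p_sum1 : \sum_a p a = 1.
Hypothesis loss01 : forall i a, 0 <= loss i a <= 1.
Context (m : nat) (eta : R).
Hypothesis m_gt0 : (0 < m)%N.
Hypothesis eta_gt0 : 0 < eta.

Definition mean_loss i : R := \sum_a p a * loss i a.

Definition sample_loss (w : m.-tuple T) i : R :=
  m%:R^-1 * \sum_(j < m) loss i (tnth w j).

Let mR_gt0 : 0 < m%:R :> R. Proof. by rewrite ltr0n. Qed.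

Lemma sample_loss_bounded_differences i :
  bounded_differences (fun w => sample_loss w i) m%:R^-1.
Proof.
move=> w w' j0 ww'; rewrite -mulrBr ler_piMr ?invr_ge0 ?ler0n// -sumrB (bigD1 j0)//=.
rewrite big1 ?addr0 => [|j /ww' ->]; last exact: subrr.
have := loss01 i (tnth w j0); have := loss01 i (tnth w' j0); lra.
Qed.

Lemma sample_mean_sample_loss i :
  sample_mean p (fun w => sample_loss w i) = mean_loss i.
Proof.
rewrite sample_meanZ sample_mean_sum.
under eq_bigr do rewrite (sample_mean_tnth p_sum1).
rewrite sumr_const card_ord -/(mean_loss i) -[mean_loss i *+ m]mulr_natl.
by rewrite mulKf ?gt_eqF.
Qed.

Section Subclass.
Context (K : pred I) (i0 : I).
Hypothesis Ki0 : K i0.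
Local Notation F := (log_partition K eta).

Lemma log_partition_bounded_differences :
  bounded_differences (fun w => F (sample_loss w)) m%:R^-1.
Proof.
move=> w w' j0 ww'; apply: (log_partition_le_sup Ki0) => // i _.
by apply: (@sample_loss_bounded_differences i w' w j0) => j /ww'.
Qed.

(** Jensen's inequality: the sample loss is unbiased, so the linear part of
    the tangent at the mean loss has expectation zero. *)
Lemma log_partition_mean_loss_le :
  F mean_loss <= sample_mean p (fun w => F (sample_loss w)).
Proof.
apply: le_trans (sample_mean_le p_ge0
  (fun w => log_partition_tangent (sample_loss w) mean_loss Ki0 eta_gt0)).
rewrite sample_meanD (sample_mean_cst p_sum1) sample_mean_sum.
rewrite big1 ?addr0// => i _; rewrite sample_meanZ.
under [X in sample_mean p X]funext do rewrite -[X in _ - X]mul1r -mulNr.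
by rewrite sample_meanD sample_meanZ (sample_mean_cst p_sum1)
  sample_mean_sample_loss mulN1r subrr mulr0.
Qed.

(** By concavity of ln it suffices to bound the expected partition function,
    and the moment generating function of a sample loss at -eta exceeds its
    value for a constant of the same mean by a factor of at most
    exp (eta^2 / (8 m)). *)
Lemma sample_mean_log_partition_le :
  sample_mean p (fun w => F (sample_loss w)) <=
  F mean_loss + eta / (8 * m%:R).
Proof.
set Z := partition_function K eta; set kappa := eta ^+ 2 / (8 * m%:R).
have Zgt0 u : 0 < Z u := partition_function_gt0 eta u Ki0.
set W := expR kappa * Z mean_loss.
have W_gt0 : 0 < W by rewrite mulr_gt0// expR_gt0.
have mean_Z : sample_mean p (fun w => Z (sample_loss w)) <= W.
  rewrite /W /Z /partition_function sample_mean_sum mulr_sumr.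
  apply: ler_sum => i _.
  under [X in sample_mean p X]funext do rewrite -mulNr.
  have mV_gt0 : 0 < m%:R^-1 :> R by rewrite invr_gt0.
  apply: (le_trans (mcdiarmid_mgf_le p_ge0 p_sum1 (- eta) mV_gt0
    (@sample_loss_bounded_differences i))).
  rewrite sample_mean_sample_loss -expRD ler_expR le_eqVlt; apply/orP; left.
  by apply/eqP; rewrite /kappa; field; rewrite gt_eqF.
(* ln is concave, hence lies below its tangent at W. *)
have ln_le z : 0 < z -> ln z <= ln W + (W^-1 * z - 1).
  move=> z_gt0; rewrite -lerBlDl -ln_div ?posrE// [_^-1 * z]mulrC.
  have : -1 < z / W - 1 by rewrite ltrBrDr addNr divr_gt0.
  by move=> /le_ln1Dx; rewrite [1 + _]addrC subrK.
have -> : F mean_loss + eta / (8 * m%:R) = eta^-1 * ln W.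
  rewrite /W lnM ?posrE ?expR_gt0// expRK /F mulrDr addrC; congr (_ + _).
  by rewrite /kappa; field; rewrite !gt_eqF.
rewrite sample_meanZ ler_wpM2l ?invr_ge0 ?(ltW eta_gt0)//.
apply: (le_trans (sample_mean_le p_ge0 (fun w => ln_le _ (Zgt0 (sample_loss w))))).
rewrite sample_meanD (sample_mean_cst p_sum1) sample_meanD sample_meanZ.
rewrite (sample_mean_cst p_sum1).
by rewrite gerDl subr_le0 mulrC ler_pdivrMr// mul1r.
Qed.

End Subclass.

(** The bias eta / (8 m) arises on one side only: a large gap forces either
    the K-term at least lambda below its expectation or the K'-term at least
    lambda above its own. *)
Lemma log_partition_gap_tail (K K' : pred I) i0 i0' (lambda : R) : K i0 -> K' i0' ->
  0 < lambda ->
  sample_mean p (fun w => (2 * lambda + eta / (8 * m%:R) <=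
    (log_partition K eta mean_loss - log_partition K eta (sample_loss w)) -
    (log_partition K' eta mean_loss - log_partition K' eta (sample_loss w)))%R%:R)
  <= 2 * expR (- (2 * lambda ^+ 2 * m%:R)).
Proof.
move=> Ki0 K'i0' lambda_gt0.
have mV_gt0 : 0 < m%:R^-1 :> R by rewrite invr_gt0.
have := mcdiarmid_lower_tail p_ge0 p_sum1 m_gt0 mV_gt0 lambda_gt0
  (log_partition_bounded_differences Ki0).
have := mcdiarmid_upper_tail p_ge0 p_sum1 m_gt0 mV_gt0 lambda_gt0
  (log_partition_bounded_differences K'i0').
have -> : 2 * lambda ^+ 2 / (m%:R * m%:R^-1 ^+ 2) = 2 * lambda ^+ 2 * m%:R.
  by field; rewrite gt_eqF.
move=> up low; rewrite [2 * expR _]mulr_natl mulr2n; apply: le_trans (lerD low up).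
rewrite -sample_meanD; apply: sample_mean_le => // w.
have := log_partition_mean_loss_le Ki0.
have := sample_mean_log_partition_le K'i0'.
set A := sample_mean _ _; set B := sample_mean _ _ => hA hB.
case: (leP (2 * lambda + _)) => [gap|_]; last by rewrite mulr0n addr_ge0.
have [lowK|lowK] := leP (log_partition K eta (sample_loss w)) (B - lambda).
  by rewrite lerDl.
rewrite add0r; suff -> : A + lambda <= log_partition K' eta (sample_loss w) by [].
lra.
Qed.

End Empirical_log_partition.

(** * Reduction to finitely many outcomes *)

Section Finite_image.
Context d (Z : measurableType d) (R : realType) (T : finType) (phi : Z -> T).
Hypothesis mphi : forall a, measurable (phi @^-1` [set a]).

Lemma measure_preimage_fin (mu : {content set Z -> \bar R}) (A : {pred T}) :
  mu (phi @^-1` [set a | a \in A]) =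
  (\sum_(a in A) mu (phi @^-1` [set a]))%E.
Proof.
have -> : phi @^-1` [set a | a \in A] =
    \bigcup_(a in [set` enum A]) phi @^-1` [set a].
  apply/seteqP; split=> z /=.
    by move=> Az; exists (phi z) => //=; rewrite mem_enum.
  by case=> a /=; rewrite mem_enum => Aa ->.
rewrite measure_fin_bigcup//.
- by rewrite -fsbig_seq ?enum_uniq// big_enum.
- by move=> a b _ _ [z [/= -> ->]].
Qed.

End Finite_image.

Section Image_distribution.
Context d (Z : measurableType d) (R : realType) (T : finType) (phi : Z -> T).
Hypothesis mphi : forall a, measurable (phi @^-1` [set a]).
Context (D : probability Z R).

Definition image_mass (a : T) : R := fine (D (phi @^-1` [set a])).

Lemma image_massE a : (image_mass a)%:E = D (phi @^-1` [set a]).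
Proof. by rewrite fineK// fin_num_measure. Qed.

Lemma image_mass_ge0 a : 0 <= image_mass a.
Proof. exact/fine_ge0/measure_ge0. Qed.

Lemma measure_image_mass (A : {pred T}) :
  D (phi @^-1` [set a | a \in A]) = (\sum_(a in A) image_mass a)%:E.
Proof.
rewrite measure_preimage_fin// -sumEFin.
by apply: eq_bigr => a _; rewrite image_massE.
Qed.

Lemma image_mass_sum1 : \sum_a image_mass a = 1.
Proof.
apply: EFin_inj; rewrite -(measure_image_mass predT) -[RHS](probability_setT D).
by congr (D _); apply/seteqP.
Qed.

(** The fibres of the coordinatewise image are boxes, whose probability is the
    product of the masses; an event that depends on the image alone is a finite
    disjoint union of them. *)
Lemma power_probability_image m (A : pred (m.-tuple T)) :
  power_probability D m [set S | A (map_tuple phi S)] =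
  (sample_mean image_mass (fun w => (A w)%:R))%:E.
Proof.
pose B w : set (m.-tuple Z) :=
  [set S | forall i, (phi @^-1` [set tnth w i]) (tnth S i)].
have fiberE w : map_tuple phi @^-1` [set w] = B w.
  apply/seteqP; split=> S /=; first by move=> <- i; rewrite /= tnth_map.
  by move=> SB; apply/eq_from_tnth => i; rewrite tnth_map; exact: SB.
have mfiber w : measurable (map_tuple phi @^-1` [set w] : set (m.-tuple Z)).
  rewrite fiberE (_ : B w = \bigcap_(i in [set: 'I_m])
      ((fun S : m.-tuple Z => tnth S i) @^-1` (phi @^-1` [set tnth w i]))).
    apply: fin_bigcap_measurable => [|i _]; first exact: finite_finset.
    rewrite -[X in measurable X]setTI; exact: measurable_tnth.
  by apply/seteqP; split => S /= h i; [move=> _; exact: h | exact: (h i)].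
transitivity (power_probability D m (map_tuple phi @^-1` [set w | w \in A])) => //.
rewrite (measure_preimage_fin mfiber) /sample_mean -sumEFin big_mkcond/=.
apply: eq_bigr => w _; rewrite -[w \in A]/(A w).
case: (A w); last by rewrite mulr0.
rewrite mulr1 fiberE (power_probabilityE D (A := fun i => phi @^-1` [set tnth w i]))//.
by rewrite -prodEFin; apply: eq_bigr => i _; rewrite image_massE.
Qed.

End Image_distribution.

(** * Error patterns *)

Lemma measurable_error_set d (X : measurableType d) (h : X -> bool) :
  measurable_fun setT h -> measurable [set z : X * bool | h z.1 <> z.2].
Proof.
move=> mh.
have -> : [set z : X * bool | h z.1 <> z.2] =
    ((h @^-1` [set true]) `*` [set false]) `|`
    ((h @^-1` [set false]) `*` [set true]).
  apply/seteqP; split=> -[x y] /=; last by case=> -[-> ->].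
  by case: (h x); case: y => //= _; [left|right].
by apply: measurableU; apply: measurableX => //; rewrite -[X in measurable X]setTI;
  apply: mh.
Qed.

Section Error_patterns.
Context d (X : measurableType d) (R : realType) (hs : seq (X -> bool)).
Local Notation I := 'I_(size hs).
Local Notation hyp := (tnth (in_tuple hs)).
Hypothesis mhs : forall h, h \in hs -> measurable_fun setT h.

(** All that the empirical errors of the hypotheses retain of an example; it
    takes finitely many values. *)
Definition error_pattern (z : X * bool) : {ffun I -> bool} :=
  [ffun i => hyp i z.1 != z.2].

Definition pattern_loss (i : I) (a : {ffun I -> bool}) : R := (a i)%:R.

Lemma measurable_error_pattern a : measurable (error_pattern @^-1` [set a]).
Proof.
have -> : error_pattern @^-1` [set a] =
    \bigcap_(i in [set: I]) [set z | (hyp i z.1 != z.2) = a i].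
  apply/seteqP; split=> z /=; first by move=> <- i _ /=; rewrite ffunE.
  by move=> za; apply/ffunP => i; rewrite ffunE; exact: za.
apply: fin_bigcap_measurable => [|i _]; first exact: finite_finset.
have mE := measurable_error_set (mhs (mem_tnth i (in_tuple hs))).
case: (a i).
  by rewrite (_ : mkset _ = [set z | hyp i z.1 <> z.2])//;
    apply/seteqP; split=> z /eqP.
rewrite (_ : mkset _ = ~` [set z | hyp i z.1 <> z.2]); first exact: measurableC.
apply/seteqP; split=> z /=; first by move=> /negbFE/eqP hz; apply.
by move=> /contrapT hz; apply/negbF/eqP.
Qed.

Lemma true_error_pattern (D : probability (X * bool)%type R) i :
  true_error D (hyp i) = mean_loss (image_mass error_pattern D) pattern_loss i.
Proof.
rewrite /true_error (_ : [set z | _] =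
    error_pattern @^-1` [set a | a \in [pred a : {ffun I -> bool} | a i]]).
  rewrite (measure_image_mass measurable_error_pattern)/= big_mkcond/=.
  apply: eq_bigr => a _; rewrite inE /pattern_loss.
  by case: (a i); rewrite ?mulr1 ?mulr0.
by apply/seteqP; split=> z /=; rewrite inE ffunE => /eqP.
Qed.

Lemma empirical_error_pattern m (S : m.-tuple (X * bool)%type) i :
  empirical_error R S (hyp i) =
  sample_loss pattern_loss (map_tuple error_pattern S) i.
Proof.
congr (_ * _); apply: eq_bigr => j _.
by rewrite /pattern_loss tnth_map ffunE.
Qed.

Lemma label_weight_partition (err : (X -> bool) -> R) eta x y : uniq hs ->
  label_weight [set` hs] err eta x y =
  partition_function [pred i : I | hyp i x == y] eta (fun i => err (hyp i)).
Proof.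
move=> hs_uniq; rewrite /label_weight.
rewrite (_ : [set h | _ /\ _] = [set` [seq h <- hs | h x == y]]); last first.
  apply/seteqP; split=> h /=; rewrite mem_filter.
    by case=> -> ->; rewrite eqxx.
  by move=> /andP[/eqP ? ->].
by rewrite -fsbig_seq ?filter_uniq// big_filter big_tnth.
Qed.

End Error_patterns.

(** * The deviation bound *)

Lemma log_ratio_diff_fin (R : realType) (a b : R) :
  log_ratio_diff a%:E b%:E = (a - b)%:E.
Proof.
rewrite /log_ratio_diff; case: eqP => [[->]|_]; first by rewrite subrr.
by rewrite -EFinB.
Qed.

Theorem theorem1 (R : realType) (d : measure_display) (X : measurableType d)
    (H : set (X -> bool)) (finH : finite_set H) (H0 : H !=set0)
    (mH : forall h, H h -> measurable_fun [set: X] h)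
    (m : nat) (m_ge1 : (1 <= m)%N)
    (D : probability (X * bool)%type R) (x : X)
    (lambda : R) (lambda_gt0 : 0 < lambda)
    (eta : R) (eta_gt0 : 0 < eta)
    (s : R) (s_sign : s = -1 \/ s = 1) :
  (power_probability D m
     [set S | (2 * lambda + eta / (8 * m%:R))%:E <=
        s%:E * log_ratio_diff (true_log_ratio H D eta x)
                              (empirical_log_ratio H S eta x)]
   <= (2 * expR (- (2 * lambda ^+ 2 * m%:R)))%:E)%E.
Proof.
have thr_gt0 : 0 < 2 * lambda + eta / (8 * m%:R).
  by rewrite addr_gt0 ?divr_gt0 ?mulr_gt0// ltr0n.
(* When all hypotheses agree at x, the difference of log ratios is 0 and stays
   below the threshold. *)
have trivial_case (E : set (m.-tuple (X * bool))) : (forall S, ~ E S) ->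
    (power_probability D m E <= (2 * expR (- (2 * lambda ^+ 2 * m%:R)))%:E)%E.
  move=> E0; rewrite (_ : E = set0); last by apply/seteqP; split=> S // /E0.
  by rewrite measure0 lee_fin mulr_ge0 ?expR_ge0.
rewrite /true_log_ratio /empirical_log_ratio /log_ratio.
case: asboolP => [_|/existsNP[h1 /not_implyP[Hh1 h1x]]].
  apply: trivial_case => S /=.
  by rewrite /log_ratio_diff eqxx mule0 lee_fin leNgt thr_gt0.
case: asboolP => [_|/existsNP[h2 /not_implyP[Hh2 h2x]]].
  apply: trivial_case => S /=.
  by rewrite /log_ratio_diff eqxx mule0 lee_fin leNgt thr_gt0.
have [hs hs_uniq Hhs] : exists2 hs, uniq hs & H = [set` hs].
  have [hs ->] := (finite_seqP _).1 finH; exists (undup hs); first exact: undup_uniq.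
  by apply/seteqP; split=> h /=; rewrite mem_undup.
subst H.
pose I := 'I_(size hs); pose hyp : I -> X -> bool := tnth (in_tuple hs).
pose K y := [pred i : I | hyp i x == y].
have [i1 K1] : exists i, K true i.
  have /(tnthP (in_tuple hs))[i e] : h2 \in hs := Hh2; exists i.
  by rewrite /= /hyp -e; case: (h2 x) h2x.
have [i2 K2] : exists i, K false i.
  have /(tnthP (in_tuple hs))[i e] : h1 \in hs := Hh1; exists i.
  by rewrite /= /hyp -e; case: (h1 x) h1x.
pose p := image_mass (@error_pattern _ X hs) D.
pose F y := log_partition (K y) eta.
have log_ratioE err : eta^-1 * ln (label_weight [set` hs] err eta x true /
    label_weight [set` hs] err eta x false) =
    F true (fun i => err (hyp i)) - F false (fun i => err (hyp i)).
  rewrite !label_weight_partition// ln_div -?mulrBr// posrE.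
  - exact: (partition_function_gt0 _ _ K1).
  - exact: (partition_function_gt0 _ _ K2).
pose G y (S : m.-tuple {ffun I -> bool}) :=
  F y (mean_loss p (@pattern_loss _ X R hs)) -
  F y (sample_loss (@pattern_loss _ X R hs) S).
pose event y S := 2 * lambda + eta / (8 * m%:R) <= G y S - G (~~ y) S.
have gap y : (power_probability D m
      [set S | event y (map_tuple (@error_pattern _ X hs) S)] <=
    (2 * expR (- (2 * lambda ^+ 2 * m%:R)))%:E)%E.
  rewrite (power_probability_image (measurable_error_pattern mH) D (event y)) lee_fin.
  have p_ge0 := image_mass_ge0 (@error_pattern _ X hs) D.
  have p_sum1 := image_mass_sum1 (measurable_error_pattern mH) D.
  have l01 i a : 0 <= @pattern_loss _ X R hs i a <= 1.
    by rewrite /pattern_loss; case: (a i); rewrite ?ler01 ?lexx.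
  case: y.
    exact: (log_partition_gap_tail p_ge0 p_sum1 l01 m_ge1 eta_gt0 K1 K2 lambda_gt0).
  exact: (log_partition_gap_tail p_ge0 p_sum1 l01 m_ge1 eta_gt0 K2 K1 lambda_gt0).
(* For s = -1 the two labels exchange roles. *)
apply: le_trans (gap (s == 1)); rewrite le_eqVlt; apply/orP; left; apply/eqP.
congr (power_probability D m _); apply/funext => S /=; apply/propext.
rewrite log_ratio_diff_fin !log_ratioE -EFinM lee_fin.
have -> : (fun i => true_error D (hyp i)) = mean_loss p (@pattern_loss _ X R hs).
  by apply/funext => i; exact: true_error_pattern.
have -> : (fun i => empirical_error R S (hyp i)) =
    sample_loss (@pattern_loss _ X R hs) (map_tuple (@error_pattern _ X hs) S).
  by apply/funext => i; exact: empirical_error_pattern.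
have N1 : (-1 == 1 :> R) = false by rewrite lt_eqF// ltrN10.
by rewrite /event /G; case: s_sign => ->; rewrite ?eqxx ?N1 /=; split; lra.
Qed.
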